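(* Let $V=\coprod_{n\ge t}V_{(n)}$ be a $\mathbb{Z}$-graded vertex algebra for some $t\in\mathbb{Z}$, let $g$ be an automorphism of $V$ with period $T$, and let $U$ be a graded subspace of $V$ such that $V=U+C_2(V)$. Let $W=\bigoplus_{n\in\frac1T\mathbb{N}}W_{(n)}$ be a $\frac1T\mathbb{N}$-graded $g$-twisted $V$-module and let $M$ be a graded subspace of $W$ such that $W=M+C_2^T(W)$. Then $W$ is linearly spanned by the vectors $$u^{(1)}_{-1-k_1+\frac{r_1}{T}}u^{(2)}_{-1-k_2+\frac{r_2}{T}}\cdots u^{(s)}_{-1-k_s+\frac{r_s}{T}}w$$ for $s\ge1$, $u^{(i)}\in U\cap V^{r_i}$, $0\le r_i\le T-1$, $1\le i\le s$, $w\in M$, $k_1\ge k_2\ge\cdots\ge k_s\ge0$.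
   Context: $\mathbb{N}$ is the set of nonnegative integers. Vertex algebras are over $\mathbb{C}$; a vertex algebra $V$ has vertex operators $Y(v,x)=\sum_{n\in\mathbb{Z}}v_nx^{-n-1}$ ($v_n\in\mathrm{End}\,V$) and vacuum $\mathbf{1}$. An automorphism of $V$ is a linear isomorphism $g$ with $gY(v,x)g^{-1}=Y(g(v),x)$ for all $v\in V$; it has period $T$ ($T$ a positive integer) if $g^T=1$. Then $V=\bigoplus_{r=0}^{T-1}V^r$ with $V^r=\{v\in V: g(v)=e^{2\pi i r/T}v\}$. A $g$-twisted $V$-module is a vector space $W$ with a linear map $Y_W(\cdot,x):V\to(\mathrm{End}\,W)[[x^{1/T},x^{-1/T}]]$, $Y_W(v,x)=\sum_{n\in\frac1T\mathbb{Z}}v_nx^{-n-1}$, such that for $u\in V^r$ ($0\le r\le T-1$), $v\in V$, $w\in W$: $Y_W(u,x)=\sum_{n\in\frac rT+\mathbb{Z}}u_nx^{-n-1}$; $u_nw=0$ for $n\in\frac rT+\mathbb{Z}$ sufficiently large; $Y_W(\mathbf{1},x)=\mathrm{Id}_W$; and $$x_0^{-1}\delta\left(\tfrac{x_1-x_2}{x_0}\right)Y_W(u,x_1)Y_W(v,x_2)w-x_0^{-1}\delta\left(\tfrac{x_2-x_1}{-x_0}\right)Y_W(v,x_2)Y_W(u,x_1)w=x_2^{-1}\left(\tfrac{x_1-x_0}{x_2}\right)^{-\frac rT}\delta\left(\tfrac{x_1-x_0}{x_2}\right)Y_W(Y(u,x_0)v,x_2)w,$$ where $\delta(x)=\sum_{n\in\mathbb{Z}}x^n$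 and binomials are expanded in nonnegative integral powers of the second variable. A $\mathbb{Z}$-graded vertex algebra is a vertex algebra with a grading $V=\coprod_{n\in\mathbb{Z}}V_{(n)}$ such that $\mathbf{1}\in V_{(0)}$ and $u_mV_{(n)}\subset V_{(n+k-m-1)}$ for $u\in V_{(k)}$, $k,m,n\in\mathbb{Z}$. A $\frac1T\mathbb{N}$-graded $g$-twisted $V$-module is a $g$-twisted $V$-module with a grading $W=\bigoplus_{n\in\frac1T\mathbb{N}}W_{(n)}$ such that $v_mW_{(n)}\subseteq W_{(n+k-m-1)}$ for $v\in V_{(k)}$, $k\in\mathbb{Z}$, $m\in\frac1T\mathbb{Z}$, $n\in\frac1T\mathbb{N}$. $C_2(V)=\mathrm{span}\{u_{-2}v: u,v\in V\}$, and $C_2^T(W)=\mathrm{span}\{u_{-2+\frac pT}w: u\in V^p,\ w\in W,\ p=0,1,\dots,T-1\}$.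
   Formalization: ''Graded subspace U'' is taken to mean graded for the Z-grading and also for the eigenspaces of g, i.e. U is the sum of the U∩V^r; with the Z-grading alone the claim fails (V=C[x,x',...,y,y',...], gy=-y, U=C[x+y',y]). *)

(* Defs.v *)
From HB Require Import structures.
From mathcomp Require Export all_boot all_order all_algebra.
From mathcomp Require Export complex.
From mathcomp Require Export boolp classical_sets functions cardinality fsbigop.
From mathcomp Require Export reals trigo.

Set Implicit Arguments.
Unset Strict Implicit.
Unset Printing Implicit Defensive.

Import Order.TTheory GRing.Theory Num.Theory.

Local Open Scope classical_set_scope.
Local Open Scope ring_scope.
Local Open Scope complex_scope.

(* The ground field is R[i] for an arbitrary R : realType.

   Infinite sums are written \sum_(i \in [set: I]) F i (fsbigop), which is the
   sum over the support of F when this support is finite. Each such sum below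
   either has finite support as part of the definition, or has finite support
   by the truncation axioms. *)

Section LinearAlgebra.
Variables (K : fieldType) (V : lmodType K).

Definition subspace (A : set V) : Prop :=
  A 0 /\ forall (a : K) (u v : V), A u -> A v -> A (a *: u + v).

Definition lspan (S : set V) : set V := smallest subspace S.

Definition hom_decomp (I : choiceType) (G : I -> set V) (f : I -> V) (v : V) :
    Prop :=
  [/\ forall i, G i (f i),
      finite_set [set i | f i != 0]
    & v = \sum_(i \in [set: I]) f i].

Definition direct_sum (I : choiceType) (G : I -> set V) : Prop :=
  (forall i, subspace (G i)) /\ forall v : V, exists! f, hom_decomp G f v.

Definition graded_subspace (I : choiceType) (G : I -> set V) (U : set V) :
    Prop :=
  subspace U /\
  forall u, U u -> exists f, hom_decomp (fun i => U `&` G i) f u.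

End LinearAlgebra.

(* a (a - 1) ... (a - i + 1) / i! *)
Definition gbinom (F : fieldType) (a : F) (i : nat) : F :=
  (\prod_(j < i) (a - j%:R)) / i`!%:R.

(* vmode v n w is v_n w, where Y(v, x) = \sum_n v_n x^(-n-1).

   va_jacobi is the Jacobi identity
     x0^-1 delta((x1 - x2) / x0) Y(u, x1) Y(v, x2) w
     - x0^-1 delta((x2 - x1) / (- x0)) Y(v, x2) Y(u, x1) w
     = x2^-1 delta((x1 - x0) / x2) Y(Y(u, x0) v, x2) w
   read off at x0^(-l-1) x1^(-m-1) x2^(-n-1), by means of the expansions
     x0^-1 delta((x1 - x2) / x0)
       = \sum_(l, i) (-1)^i binom(l, i) x0^(-l-1) x1^(l-i) x2^i
     x0^-1 delta((x2 - x1) / (- x0))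
       = \sum_(l, i) (-1)^l (-1)^i binom(l, i) x0^(-l-1) x1^i x2^(l-i)
     x2^-1 delta((x1 - x0) / x2)
       = \sum_(k, i) (-1)^i binom(k, i) x0^i x1^(k-i) x2^(-k-1)
   with l, k in Z and i in N; in the last one k = i - m - 1. *)
Record vertexAlgebra (R : realType) := VertexAlgebra {
  va_sort :> lmodType R[i];
  vmode : va_sort -> int -> va_sort -> va_sort;
  vac : va_sort;
  vmode_linear : forall v n, linear (vmode v n);
  vmode_linearl : forall n w, linear (fun v => vmode v n w);
  va_truncation : forall u v,
    exists N : int, forall n : int, N <= n -> vmode u n v = 0;
  va_vacuum : forall n w, vmode vac n w = if n == -1 then w else 0;
  va_creation : forall v,
    vmode v (-1) vac = v /\ forall n : int, 0 <= n -> vmode v n vac = 0;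
  va_jacobi : forall (u v w : va_sort) (l m n : int),
    \sum_(i \in [set: nat])
        ((-1) ^+ i * gbinom (l%:~R : R[i]) i) *:
          vmode u (m + l - i%:Z) (vmode v (n + i%:Z) w)
    - \sum_(i \in [set: nat])
        ((-1) ^ l * (-1) ^+ i * gbinom (l%:~R : R[i]) i) *:
          vmode v (n + l - i%:Z) (vmode u (m + i%:Z) w)
    = \sum_(i \in [set: nat])
        ((-1) ^+ i * gbinom ((i%:Z - m - 1)%:~R : R[i]) i) *:
          vmode (vmode u (l + i%:Z) v) (m + n - i%:Z) w }.

Definition is_automorphism (R : realType) (V : vertexAlgebra R) (g : V -> V) :
    Prop :=
  [/\ linear g, bijective g
    & forall v n w, g (vmode v n w) = vmode (g v) n (g w)].

Definition has_period (A : Type) (g : A -> A) (T : nat) : Prop :=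
  (0 < T)%N /\ iter T g =1 id.

Definition expi (R : realType) (x : R) : R[i] := (cos x) +i* (sin x).

Definition eigenspace_of (R : realType) (V : lmodType R[i]) (g : V -> V)
    (T : nat) (r : 'I_T) : set V :=
  [set v | g v = expi (2 * pi * r%:R / T%:R) *: v].

(* r / T + Z *)
Definition coset (T r : nat) : set rat :=
  [set n | n - r%:R / T%:R \is a Num.int].

(* tmode v n w is v_n w for n in (1/T) Z, and is 0 for every other rational n.

   tw_jacobi is the twisted Jacobi identity read off at
   x0^(-l-1) x1^(-m-1) x2^(-n-1). The left-hand side is expanded as in the
   untwisted case, and on the right-hand side
     x2^-1 ((x1 - x0) / x2)^(-r/T) delta((x1 - x0) / x2)
       = \sum_(k, i) (-1)^i binom(k - r/T, i)
                       x0^i x1^(k - r/T - i) x2^(-1 - k + r/T),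
   with k in Z and i in N, so that k - r/T = i - m - 1. For m outside r/T + Z
   both sides have coefficient 0. *)
Record twistedModule (R : realType) (V : vertexAlgebra R) (g : V -> V)
    (T : nat) := TwistedModule {
  tw_sort :> lmodType R[i];
  tmode : V -> rat -> tw_sort -> tw_sort;
  tmode_linear : forall v n, linear (tmode v n);
  tmode_linearl : forall n w, linear (fun v => tmode v n w);
  tmode_exponent : forall v n w, n * T%:R \isn't a Num.int -> tmode v n w = 0;
  tw_coset : forall (r : 'I_T) u n w,
    eigenspace_of g r u -> ~ coset T r n -> tmode u n w = 0;
  tw_truncation : forall (r : 'I_T) u w, eigenspace_of g r u ->
    exists N : rat, forall n : rat, coset T r n -> N <= n -> tmode u n w = 0;
  tw_vacuum : forall n w, tmode (vac V) n w = if n == -1 then w else 0;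
  tw_jacobi : forall (r : 'I_T) (u v : V) (w : tw_sort) (l : int) (m n : rat),
    eigenspace_of g r u -> coset T r m ->
    \sum_(i \in [set: nat])
        ((-1) ^+ i * gbinom (l%:~R : R[i]) i) *:
          tmode u (m + l%:~R - i%:R) (tmode v (n + i%:R) w)
    - \sum_(i \in [set: nat])
        ((-1) ^ l * (-1) ^+ i * gbinom (l%:~R : R[i]) i) *:
          tmode v (n + l%:~R - i%:R) (tmode u (m + i%:R) w)
    = \sum_(i \in [set: nat])
        ((-1) ^+ i * gbinom (ratr (i%:R - m - 1) : R[i]) i) *:
          tmode (vmode u (l + i%:Z) v) (m + n - i%:R) w }.

Definition is_Zgrading (R : realType) (V : vertexAlgebra R)
    (VG : int -> set V) : Prop :=
  [/\ direct_sum VG, VG 0 (vac V)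
    & forall (k m n : int) u v,
        VG k u -> VG n v -> VG (n + k - m - 1) (vmode u m v)].

(* WG is indexed by all rationals, and WG n = 0 unless n is in (1/T) N. In
   particular v_m w = 0 when the weight of v_m w is not in (1/T) N. *)
Definition is_TNgrading (R : realType) (V : vertexAlgebra R) (g : V -> V)
    (T : nat) (VG : int -> set V) (W : twistedModule g T)
    (WG : rat -> set W) : Prop :=
  [/\ direct_sum WG,
      forall n, ~ (exists j : nat, n = j%:R / T%:R) -> WG n `<=` [set 0]
    & forall (k : int) (m n : rat) v w,
        VG k v -> WG n w -> WG (n + k%:~R - m - 1) (tmode v m w)].

Definition C2 (R : realType) (V : vertexAlgebra R) : set V :=
  lspan [set x | exists u v : V, x = vmode u (-2) v].

Definition C2T (R : realType) (V : vertexAlgebra R) (g : V -> V) (T : nat)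
    (W : twistedModule g T) : set W :=
  lspan [set x | exists (p : 'I_T) (u : V) (w : W),
           eigenspace_of g p u /\ x = tmode u (- 2 + p%:R / T%:R) w].

(* The vectors u1_(-1-k1+r1/T) ... us_(-1-ks+rs/T) w with s >= 1 and
   k1 >= ... >= ks >= 0, indexed from 0. *)
Definition spanning_vectors (R : realType) (V : vertexAlgebra R) (g : V -> V)
    (T : nat) (W : twistedModule g T) (U : set V) (M : set W) : set W :=
  [set x | exists (s : nat) (u : 'I_s -> V) (r : 'I_s -> 'I_T)
                  (k : 'I_s -> nat) (w : W),
     [/\ (1 <= s)%N,
         forall i, (U `&` eigenspace_of g (r i)) (u i),
         forall i j : 'I_s, (i <= j)%N -> (k j <= k i)%N,
         M w
       & x = foldr (fun i y =>
                      tmode (u i) (- 1 - (k i)%:R + (r i)%:R / T%:R) y)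
                   w (enum 'I_s)]].

(* Main.v *)
(* Give a mode u_n the depth -1 - floor n, so that the modes occurring in the
   spanning vectors are exactly those of nonnegative depth, ordered by depth
   when they are ordered by n. Let E_N be the span of the words in modes u_n,
   n < 0, of total depth at least N, applied to W. The Jacobi identity shows
   that all modes are compatible with this filtration, that two modes commute
   up to shorter words of at least the same total depth, and that the modes of
   C_2(V) gain one degree. By induction on the length of words,
   W = X + E_N for every N, where X is spanned by the sorted words in U on M.

   It remains to see that a homogeneous component of W does not meet E_N for N
   large. Weights of V may be negative, so the depth of a word does not bound
   its weight; but the associativity formula merges two modes u_n, v_m with
   n, m <= -d < -1 into modes of index at most -d - 1/T. Hence
   E_N lies in the span of all v_n y with n <= -d once N is large, and these
   have weight at least t + d - 1. *)
Require Import Defs.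
From mathcomp Require Import zify ring lra.

Set Implicit Arguments.
Unset Strict Implicit.
Unset Printing Implicit Defensive.

Import Order.TTheory GRing.Theory Num.Theory.

Local Open Scope classical_set_scope.
Local Open Scope ring_scope.
Local Open Scope complex_scope.

(** * Subspaces and finitely supported sums *)

Section Subspaces.
Variables (K : fieldType) (V : lmodType K).
Implicit Types (A B S : set V) (x y : V) (a : K).

Lemma subspace0 A : subspace A -> A 0.
Proof. by case. Qed.

Lemma subspaceD A x y : subspace A -> A x -> A y -> A (x + y).
Proof. by case=> _ h hx hy; rewrite -[x]scale1r; apply: h. Qed.

Lemma subspaceZ A a x : subspace A -> A x -> A (a *: x).
Proof. by case=> h0 h hx; rewrite -[_ *: _]addr0; apply: h. Qed.

Lemma subspaceB A x y : subspace A -> A x -> A y -> A (x - y).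
Proof.
move=> hA hx hy; rewrite -scaleN1r.
by apply: subspaceD => //; apply: subspaceZ.
Qed.

Lemma subspaceBr A x y : subspace A -> A (x - y) -> A y -> A x.
Proof. by move=> hA h1 h2; rewrite -(subrK y x); apply: subspaceD. Qed.

Lemma subspace_sum A (I : Type) (r : seq I) (F : I -> V) :
  subspace A -> (forall i, A (F i)) -> A (\sum_(i <- r) F i).
Proof.
move=> hA hF; elim/big_ind: _ => //; first exact: subspace0.
by move=> x y; apply: subspaceD.
Qed.

(** No finiteness is assumed: over an infinite support the sum is 0 by convention, and 0 lies in
    [A]. *)
Lemma subspace_fsum A (I : choiceType) (D : set I) (F : I -> V) :
  subspace A -> (forall i, D i -> A (F i)) -> A (\sum_(i \in D) F i).
Proof.
move=> hA hF; have h0 := subspace0 hA.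
rewrite fsbig_mkcond; case: finite_supportP => [_|X _ _ _].
  by rewrite big_nil.
apply: subspace_sum => // i; rewrite /patch; case: ifPn => //.
by rewrite inE => /hF.
Qed.

Lemma subspace_lspan S : subspace (lspan S).
Proof.
split=> [B [[]//]|a u v hu hv B [hB SB]].
by case: (hB) => _; apply; [apply: hu|apply: hv].
Qed.

Lemma lspan_sub S A : subspace A -> S `<=` A -> lspan S `<=` A.
Proof. exact: smallest_sub. Qed.

Lemma sub_lspan S : S `<=` lspan S.
Proof. exact: sub_gen_smallest. Qed.

Lemma lspan_mono S S' : S `<=` lspan S' -> lspan S `<=` lspan S'.
Proof. by move=> h; apply: lspan_sub => //; apply: subspace_lspan. Qed.

Definition addset A B : set V := [set a + b | a in A & b in B].

Lemma subspace_addset A B : subspace A -> subspace B -> subspace (addset A B).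
Proof.
move=> hA hB; split.
  by exists 0; [exact: subspace0|exists 0; [exact: subspace0|rewrite addr0]].
move=> c _ _ [a ha [b hb <-]] [a' ha' [b' hb' <-]].
exists (c *: a + a'); first by case: hA => _; apply.
exists (c *: b + b'); first by case: hB => _; apply.
by rewrite scalerDr addrACA.
Qed.

Lemma addset_l A B : subspace B -> A `<=` addset A B.
Proof.
by move=> hB x hx; exists x => //; exists 0; rewrite ?addr0//; apply: subspace0.
Qed.

Lemma addset_r A B : subspace A -> B `<=` addset A B.
Proof.
by move=> hA x hx; exists 0; [apply: subspace0|exists x; rewrite ?add0r].
Qed.

Lemma fsum_eq0term (F : nat -> V) :
  (forall i, F i.+1 = 0) -> \sum_(i \in [set: nat]) F i = F 0%N.
Proof.
move=> hF; rewrite -(@fsbig_widen _ _ _ _ [set 0%N])//; first exact: fsbig_set1.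
by move=> [|i] [_ /= h]; [case: h|apply: hF].
Qed.

(** Isolates the leading term of a sum in the Jacobi identity. The bound [N] keeps the support
    finite; otherwise the sum could be 0 by convention. *)
Lemma fsum_sep A (F : nat -> V) (N : nat) : subspace A ->
  (forall i, (N <= i)%N -> F i = 0) -> (forall i, A (F i.+1)) ->
  A (\sum_(i \in [set: nat]) F i - F 0%N).
Proof.
move=> hA h0 hF.
have -> : \sum_(i \in [set: nat]) F i = \sum_(i \in `I_N.+1) F i.
  apply/esym/fsbig_widen => //= i [_ /= /negP]; rewrite -leqNgt => ?.
  by apply: h0; exact: ltnW.
rewrite -fsbig_ord big_ord_recl addrC addKr.
by apply: subspace_sum => // i; apply: hF.
Qed.

End Subspaces.

Section LinearMaps.
Variables (K : fieldType) (V W : lmodType K) (f : V -> W).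
Hypothesis hf : linear f.

Lemma lin0 : f 0 = 0.
Proof. by have := hf (-1) 0 0; rewrite scaler0 addr0 scaleN1r addNr. Qed.

Lemma linD : {morph f : x y / x + y}.
Proof. by move=> x y; have := hf 1 x y; rewrite !scale1r. Qed.

Lemma linZ a x : f (a *: x) = a *: f x.
Proof. by have := hf a x 0; rewrite !addr0 lin0 addr0. Qed.

Lemma linB : {morph f : x y / x - y}.
Proof. by move=> x y; rewrite linD -scaleN1r linZ scaleN1r. Qed.

Lemma linsum (I : Type) (r : seq I) (F : I -> V) :
  f (\sum_(i <- r) F i) = \sum_(i <- r) f (F i).
Proof. exact: (big_morph f linD lin0). Qed.

Lemma subspace_preim (A : set W) : subspace A -> subspace (f @^-1` A).
Proof.
by case=> h0 h; split => [|a u v] /=; rewrite ?lin0// hf; apply: h.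
Qed.

End LinearMaps.

(** * Binomial coefficients and the depth of a mode *)

Lemma gbinomx0 (F : fieldType) (a : F) : gbinom a 0 = 1.
Proof. by rewrite /gbinom big_ord0 fact0 divr1. Qed.

Lemma gbinom0S (F : fieldType) i : gbinom (0 : F) i.+1 = 0.
Proof. by rewrite /gbinom big_ord_recl subrr !mul0r. Qed.

(** For n = -1 - k + r/T with 0 <= r < T this is k. *)
Definition mdepth (n : rat) : int := - 1 - Num.floor n.

Lemma mdepth_ge (n : rat) (j : int) : (j <= mdepth n) = (n < (- j)%:~R).
Proof. by rewrite -floor_lt_int /mdepth; move: (Num.floor n) => f; lia. Qed.

Lemma mdepth_lt (n : rat) : n < - (mdepth n)%:~R.
Proof. by have := lexx (mdepth n); rewrite mdepth_ge rmorphN. Qed.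

Lemma mdepth_geq0 (n : rat) : (0 <= mdepth n) = (n < 0).
Proof. by rewrite mdepth_ge oppr0. Qed.

Lemma mdepth_anti (m n : rat) : m <= n -> mdepth n <= mdepth m.
Proof. by move=> h; rewrite mdepth_ge rmorphN; have := mdepth_lt n; lra. Qed.

(** The -1 in [mdepth] absorbs the possible carry in floor (m + n) <= floor m + floor n + 1. Thus
    merging two modes never loses depth. *)
Lemma mdepth_super (m n : rat) (i : nat) :
  mdepth m + mdepth n + i%:Z <= mdepth (m + n - i%:R).
Proof.
rewrite mdepth_ge; have := mdepth_lt n; have := mdepth_lt m.
by move: (mdepth m) (mdepth n) => a b; rewrite rmorphN !rmorphD /= pmulrn; lra.
Qed.

Lemma mdepthDint (n : rat) (j : int) : mdepth (n + j%:~R) = mdepth n - j.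
Proof. by rewrite /mdepth floorDrz ?intr_int// intrKfloor opprD addrA. Qed.

Lemma mdepthDnat (n : rat) (j : nat) : mdepth (n + j%:R) = mdepth n - j%:Z.
Proof. by rewrite -mdepthDint. Qed.

Lemma mdepthBnat (n : rat) (j : nat) : mdepth (n - j%:R) = mdepth n + j%:Z.
Proof. by rewrite -[j%:R]/(j%:~R) -rmorphN mdepthDint; lia. Qed.

(** * Decomposition into eigenspaces *)

Lemma sum_shift (V : nmodType) (F : nat -> V) n :
  F n = F 0%N -> \sum_(j < n) F j.+1 = \sum_(j < n) F j.
Proof.
case: n => [|n] Fn; first by rewrite !big_ord0.
by rewrite big_ord_recr [RHS]big_ord_recl /= Fn addrC.
Qed.

Section Eigenspaces.
Variable R : realType.

Lemma expi0 : expi (0 : R) = 1.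
Proof. by rewrite /expi cos0 sin0. Qed.

Lemma expiD (x y : R) : expi (x + y) = expi x * expi y.
Proof.
rewrite /expi cosD sinD; apply/eqP; rewrite eq_complex /=.
by rewrite eqxx addrC [sin x * _]mulrC eqxx.
Qed.

Lemma expi_nat (x : R) n : expi (x * n%:R) = expi x ^+ n.
Proof.
elim: n => [|n IH]; first by rewrite mulr0 expi0.
by rewrite -natr1 mulrDr mulr1 expiD IH exprSr.
Qed.

Lemma expi_2pi : expi (2 * pi : R) = 1.
Proof.
have -> : 2 * pi = pi + pi :> R by ring.
have e : expi (pi : R) = -1.
  by rewrite /expi cospi sinpi; apply/eqP; rewrite eq_complex /= oppr0 !eqxx.
by rewrite expiD e mulrNN mulr1.
Qed.

Lemma expi_neq1 (x : R) : 0 < x < 2 * pi -> expi x != 1.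
Proof.
move=> /andP[x0 x2]; apply/negP; rewrite eq_complex /= => /andP[/eqP c /eqP s].
have [xp|xp|xp] := ltgtP x pi.
- by have := @sin_gt0_pi R x; rewrite x0 xp s ltxx => /(_ isT).
- have : 0 < sin (x - pi) by apply: sin_gt0_pi; apply/andP; split; lra.
  have := sinDpi (x - pi); rewrite subrK s => /eqP.
  by rewrite eq_sym oppr_eq0 => /eqP ->; rewrite ltxx.
- by move: c; rewrite xp cospi; lra.
Qed.

Section Decomposition.
Variables (V : lmodType R[i]) (g : V -> V) (T : nat).
Hypotheses (hg : linear g) (hT : has_period g T).

Let e : R[i] := expi (2 * pi / T%:R).

Lemma expi_root r : expi (2 * pi * r%:R / T%:R) = e ^+ r.
Proof. by rewrite -expi_nat mulrAC. Qed.

Lemma root_exprT : e ^+ T = 1.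
Proof.
case: hT => T0 _; rewrite -expi_root mulfK ?expi_2pi//.
by rewrite pnatr_eq0 -lt0n.
Qed.

Lemma root_neq0 : e != 0.
Proof.
have := root_exprT; case: hT; case: T e => // t e' _ _.
by rewrite exprS; apply: contra_eq_neq => ->; rewrite mul0r eq_sym oner_neq0.
Qed.

Lemma root_neq1 j : (0 < j < T)%N -> e ^+ j != 1.
Proof.
move=> /andP[j0 jT]; rewrite -expi_root; apply: expi_neq1.
have T0 : 0 < T%:R :> R by rewrite ltr0n; case: hT.
have p0 : 0 < 2 * pi :> R by rewrite mulr_gt0 ?pi_gt0.
apply/andP; split; first by rewrite divr_gt0// mulr_gt0// ltr0n.
by rewrite ltr_pdivrMr// ltr_pM2l ?ltr_nat.
Qed.

(** Discrete Fourier inversion with the root of unity [e]: the component of index r is the average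
    of e^(-r j) g^j v over j < T. Applying g shifts j cyclically, and summing over r leaves only j =
    0. *)
Lemma eigen_decomp (v : V) : exists f : 'I_T -> V,
  (forall r, eigenspace_of g r (f r)) /\ v = \sum_r f r.
Proof.
have [T0 gT] := hT.
have TR0 : T%:R != 0 :> R[i] by rewrite pnatr_eq0 -lt0n.
exists (fun r => T%:R^-1 *: \sum_(j < T) (e ^- r) ^+ j *: iter j g v); split.
  move=> r; rewrite /eigenspace_of /= expi_root.
  rewrite (linZ hg) scalerA mulrC -scalerA.
  congr (_ *: _); rewrite (linsum hg) scaler_sumr.
  pose F j := e ^+ r *: ((e ^- r) ^+ j *: iter j g v).
  rewrite (eq_bigr (fun j : 'I_T => F j.+1)) => [|j _]; last first.
    rewrite /F (linZ hg) iterS [RHS]scalerA exprS mulrA divff ?mul1r//.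
    by rewrite expf_neq0 ?root_neq0.
  have FT : F T = F 0%N.
    by rewrite /F gT /= expr0 exprVn exprAC root_exprT expr1n invr1.
  exact: sum_shift.
rewrite -scaler_sumr exchange_big /=.
under eq_bigr => j _ do rewrite -scaler_suml.
rewrite (bigD1 (Ordinal T0))//= [X in _ + X]big1 ?addr0 => [|j j0].
  under eq_bigr => r _ do rewrite expr0.
  by rewrite sumr_const card_ord scalerA mulVf// scale1r.
under eq_bigr => r _ do rewrite exprVn exprAC -exprVn.
(* For 0 < j < T the sum over r is geometric with ratio e^(-j), a T-th root of unity other than 1,
   so it vanishes. *)
have /eqP : (e ^- j) ^+ T - 1 = 0.
  by rewrite exprVn exprAC root_exprT expr1n invr1 subrr.
rewrite subrX1 mulf_eq0 subr_eq0 invr_eq1 => /orP[|/eqP ->]; last first.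
  by rewrite scale0r.
by move=> /negPn/negP[]; apply: root_neq1; rewrite ltn_ord lt0n andbT.
Qed.

End Decomposition.
End Eigenspaces.

(** * Consequences of the twisted Jacobi identity *)

Section Twisted.
Variables (R : realType) (V : vertexAlgebra R) (g : V -> V) (T : nat).
Hypotheses (hg : linear g) (hT : has_period g T).
Variable W : twistedModule g T.
Implicit Types (u v x : V) (w y : W) (m n : rat) (A : set W).

Let T0 : T%:R != 0 :> rat.
Proof. by rewrite pnatr_eq0 -lt0n; case: hT. Qed.

Lemma mem_coset m : m * T%:R \is a Num.int -> exists r : 'I_T, coset T r m.
Proof.
move=> /intrP[z mz].
have Tz : T%:Z != 0 by case: hT; rewrite -lt0n; lia.
have h : (`|(z %% T%:Z)%Z| < T)%N.
  by have := ltz_mod z Tz; have := modz_ge0 z Tz; lia.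
exists (Ordinal h); rewrite /coset /=; apply/intrP; exists (z %/ T%:Z)%Z.
apply: (mulIf T0); rewrite mulrBl mz mulfVK// {1}(divz_eq z T%:Z).
have -> : `|(z %% T)%Z|%:R = (z %% T)%Z%:~R :> rat.
  by rewrite -[in RHS](gez0_abs (modz_ge0 z Tz)).
by rewrite rmorphD rmorphM /= addrK.
Qed.

Lemma coset_shift (r : nat) m n : n \is a Num.int -> coset T r m ->
  coset T r (m + n).
Proof. by rewrite /coset /= addrAC => ? ?; apply: rpredD. Qed.

Lemma coset_inj (r s : 'I_T) m : coset T r m -> coset T s m -> r = s.
Proof.
rewrite /coset /= => hr hs; have := rpredB hs hr.
have -> : m - s%:R / T%:R - (m - r%:R / T%:R) = (r%:R - s%:R) / T%:R.
  by rewrite mulrBl; ring.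
move=> /intrP[z] /(congr1 (fun a => a * T%:R)).
rewrite mulfVK// => e.
have {}e : r%:Z - s%:Z = z * T%:Z.
  by apply: (@intr_inj rat); rewrite rmorphB rmorphM.
apply: val_inj => /=; have := ltn_ord r; have := ltn_ord s.
by case: z e => [[|z]|z]; nia.
Qed.

Lemma tmode_eigensum (f : 'I_T -> V) (r : 'I_T) n w :
  (forall s, eigenspace_of g s (f s)) -> coset T r n ->
  tmode (\sum_s f s) n w = tmode (f r) n w.
Proof.
move=> hf hn; rewrite (linsum (@tmode_linearl _ _ _ _ W n w)).
rewrite (bigD1 r)//= big1 ?addr0// => s sr.
by rewrite (tw_coset _ (hf s))// => /(coset_inj hn) e; rewrite e eqxx in sr.
Qed.

(** The exponents in one coset see only one eigencomponent of [u]. This extends the Jacobi identity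
    to vectors that are not eigenvectors of g. *)
Lemma tmode_component u m : m * T%:R \is a Num.int ->
  exists (r : 'I_T) (u' : V), [/\ eigenspace_of g r u', coset T r m
    & forall n w, coset T r n -> tmode u n w = tmode u' n w].
Proof.
move=> /mem_coset[r hr]; have [f [hf ->]] := eigen_decomp hg hT u.
exists r, (f r); split=> // n w; exact: tmode_eigensum.
Qed.

Lemma tmode_trunc v n w :
  exists N : nat, forall i, (N <= i)%N -> tmode v (n + i%:R) w = 0.
Proof.
have [hn|hn] := boolP (n * T%:R \is a Num.int); last first.
  exists 0%N => i _; apply: tmode_exponent; apply: contra hn => h.
  rewrite -(addrK i%:R n) mulrBl; apply: rpredB => //.
  by rewrite rpredM ?natr_int.
have [r [v' [hv' hr e]]] := tmode_component v hn.
have [N hN] := tw_truncation w hv'.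
exists `|Num.ceil (N - n)|%N => i hi.
have hc : coset T r (n + i%:R) by apply: coset_shift; rewrite ?natr_int.
rewrite e// hN// -lerBlDl; apply: le_trans (ceil_ge _) _.
by rewrite pmulrn ler_int; move: (Num.ceil _) hi => z; lia.
Qed.

(** All modes of [u] on the left have index in m + Z, so there [u] and its eigencomponent [u']
    agree. The coefficients on the right stay anonymous, since only membership in subspaces will be
    tracked. *)
Lemma tmode_jacobi u v w (l : int) m n : m * T%:R \is a Num.int ->
  exists (u' : V) (c : nat -> R[i]),
  c 0%N = 1 /\
    \sum_(i \in [set: nat])
        ((-1) ^+ i * gbinom (l%:~R : R[i]) i) *:
          tmode u (m + l%:~R - i%:R) (tmode v (n + i%:R) w)
    - \sum_(i \in [set: nat])
        ((-1) ^ l * (-1) ^+ i * gbinom (l%:~R : R[i]) i) *: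
          tmode v (n + l%:~R - i%:R) (tmode u (m + i%:R) w)
    = \sum_(i \in [set: nat])
        c i *: tmode (vmode u' (l + i%:Z) v) (m + n - i%:R) w.
Proof.
move=> /tmode_component-/(_ u)[r [u' [hu' hr e]]].
exists u', (fun i => (-1) ^+ i * gbinom (ratr (i%:R - m - 1) : R[i]) i); split.
  by rewrite gbinomx0 mulr1.
rewrite -(tw_jacobi v w l n hu' hr); congr (_ - _); apply: eq_fsbigr => i _.
  rewrite e//; apply: coset_shift; rewrite ?rpredN ?natr_int//.
  by apply: coset_shift; rewrite ?intr_int.
by rewrite e//; apply: coset_shift; rewrite ?natr_int.
Qed.

Lemma tmode0r u m : tmode u m (0 : W) = 0.
Proof. exact: lin0 (tmode_linear u m). Qed.

(** Commutator formula, the Jacobi identity with l = 0: binom(0, i) leaves only i = 0 in both sums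
    on the left. *)
Lemma tmode_comm_mem A u v w m n : subspace A ->
  (forall (i : nat) x, A (tmode x (m + n - i%:R) w)) ->
  A (tmode u m (tmode v n w) - tmode v n (tmode u m w)).
Proof.
move=> hA h; have [hm|hm] := boolP (m * T%:R \is a Num.int); last first.
  by rewrite !(tmode_exponent u _ hm) tmode0r subrr; apply: subspace0.
have [u' [c [_ ]]] := tmode_jacobi u v w 0 n hm.
rewrite fsum_eq0term => [|i]; last by rewrite gbinom0S mulr0 scale0r.
rewrite fsum_eq0term => [|i]; last by rewrite gbinom0S mulr0 scale0r.
rewrite expr0 expr0z !mul1r gbinomx0 !scale1r mulr0z !mulr0n !addr0 => ->.
by apply: subspace_fsum => // i _; apply: subspaceZ.
Qed.

(** The Jacobi identity with l = -1, solved for the term i = 0 of its first sum. The three families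
    of hypotheses cover the merged modes on the right, the rest of the first sum, and the second
    sum. *)
Lemma tmode_assoc_mem A u v w m n : subspace A ->
  (forall (i : nat) x, A (tmode x (m + n - i%:R) w)) ->
  (forall i : nat, A (tmode u (m - 1 - i.+1%:R) (tmode v (n + i.+1%:R) w))) ->
  (forall i : nat, A (tmode v (n - 1 - i%:R) (tmode u (m + i%:R) w))) ->
  A (tmode u (m - 1) (tmode v n w)).
Proof.
move=> hA h1 h2 h3.
have [hm|hm] := boolP (m * T%:R \is a Num.int); last first.
  rewrite tmode_exponent; first exact: subspace0.
  apply: contra hm => h; rewrite -(subrK 1 m) mulrDl mul1r.
  by apply: rpredD; rewrite ?natr_int.
have [u' [c [_ e]]] := tmode_jacobi u v w (-1) n hm.
have [N hN] := tmode_trunc v n w.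
move: e; set S1 := (X in X - _ = _); set S2 := (X in _ - X = _) => e.
have S1A : A S1.
  apply: (@subspaceBr _ _ _ _ S2) => //; last first.
    by apply: subspace_fsum => // i _; apply: subspaceZ.
  by rewrite e; apply: subspace_fsum => // i _; apply: subspaceZ.
pose F i : W := ((-1) ^+ i * gbinom ((-1)%:~R : R[i]) i) *:
  tmode u (m + (-1)%:~R - i%:R) (tmode v (n + i%:R) w).
have : A (S1 - F 0%N).
  apply: (@fsum_sep _ _ A F N) => // i => [hi|]; rewrite /F.
    by rewrite hN// tmode0r scaler0.
  exact: subspaceZ.
rewrite /F gbinomx0 mulr1 scale1r !addr0 mulrN1z => h.
by rewrite -(subKr S1 (tmode _ _ _)); apply: subspaceB.
Qed.

(* The Jacobi identity with [l = -2], whose right-hand side has the leading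
   term [(u_(-2) v)_(m+n) w]. *)
Lemma tmode_iter_mem A (r : 'I_T) u v w m n : subspace A ->
  eigenspace_of g r u -> coset T r m ->
  (forall (i : nat) x, A (tmode x (m + n - i.+1%:R) w)) ->
  (forall i : nat, A (tmode u (m - 2 - i%:R) (tmode v (n + i%:R) w))) ->
  (forall i : nat, A (tmode v (n - 2 - i%:R) (tmode u (m + i%:R) w))) ->
  A (tmode (vmode u (-2) v) (m + n) w).
Proof.
move=> hA hu hm h1 h2 h3.
have := tw_jacobi v w (-2) n hu hm.
set S1 := (X in X - _ = _); set S2 := (X in _ - X = _) => e.
have m2 : (-2)%:~R = - 2 :> rat by [].
have S1A : A S1.
  by apply: subspace_fsum => // i _; apply: subspaceZ => //; rewrite m2.
have S2A : A S2.
  by apply: subspace_fsum => // i _; apply: subspaceZ => //; rewrite m2.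
have [N hN] := va_truncation u v.
pose F i : W := ((-1) ^+ i * gbinom (ratr (i%:R - m - 1) : R[i]) i) *:
  tmode (vmode u (-2 + i%:Z) v) (m + n - i%:R) w.
have : A (S1 - S2 - F 0%N).
  rewrite e; apply: (@fsum_sep _ _ A F (absz (N + 2)%R)) => // i => [hi|].
    rewrite /F.
    rewrite hN; last by lia.
    by rewrite (lin0 (@tmode_linearl _ _ _ _ W _ w)) scaler0.
  exact: subspaceZ.
rewrite /F gbinomx0 mulr1 scale1r !addr0 => h.
rewrite -(subKr (S1 - S2) (tmode _ _ _)); apply: subspaceB => //.
exact: subspaceB.
Qed.

End Twisted.

(** * The depth filtration *)

Section Filtration.
Variables (R : realType) (V : vertexAlgebra R) (g : V -> V) (T : nat).
Hypotheses (hg : linear g) (hT : has_period g T).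
Variable W : twistedModule g T.
Implicit Types (u v x : V) (w y z : W) (m n d : rat) (A : set W).
Implicit Types (M N c : int).

Let T0 : 0 < T%:R :> rat.
Proof. by rewrite ltr0n; case: hT. Qed.

(** The space E_N, in inductive form so that an induction on membership peels off the outermost
    mode. The inequalities in [EF_top] and [EF_mode] make the family decreasing in N. *)
Inductive EF : int -> W -> Prop :=
| EF_top N w : N <= 0 -> EF N w
| EF_mode u n N M w : n < 0 -> EF N w -> M <= N + mdepth n -> EF M (tmode u n w)
| EF_zero N : EF N 0
| EF_lin N a w y : EF N w -> EF N y -> EF N (a *: w + y).

Lemma subspace_EF N : subspace (EF N).
Proof. by split=> [|a w y]; [exact: EF_zero|exact: EF_lin]. Qed.

Lemma EF_mono M N w : EF N w -> M <= N -> EF M w.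
Proof.
move=> h; elim: h M => {N w} [N w N0 M MN|u n N N' w n0 h _ N'N M MN'|N M _|].
- by apply: EF_top; apply: le_trans N0.
- by apply: EF_mode h _ => //; apply: le_trans N'N.
- exact: EF_zero.
- by move=> N a w y _ IHw _ IHy M MN; apply: EF_lin; [exact: IHw|exact: IHy].
Qed.

(** Nonnegative n, where the depth is negative, is allowed. The mode u_n is commuted past the
    outermost mode v_p; the correction terms are single modes of depth at least
    [mdepth n + mdepth p] on the inner vector, so the induction hypothesis covers them. *)
Lemma EF_tmode M N u n w : EF N w -> M <= N + mdepth n -> EF M (tmode u n w).
Proof.
move=> h; elim: h u n M => {N w} [N w N0|v p N N' w p0 h IH N'N|N|].
- move=> u n M MN; have [n0|n0] := ltP n 0.
    by apply: EF_mode MN => //; exact: EF_top.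
  have : (0 <= mdepth n) = false by rewrite mdepth_geq0 ltNge n0.
  by move=> ?; apply: EF_top; lia.
- move=> u n M MN; apply: (@subspaceBr _ _ _ _ (tmode v p (tmode u n w))).
  + exact: subspace_EF.
  + apply: (tmode_comm_mem hg hT); first exact: subspace_EF.
    by move=> i x; apply: IH; have := mdepth_super n p i; lia.
  + by apply: (@EF_mode _ _ (N + mdepth n)) => //; [exact: IH|lia].
- by move=> u n M _; rewrite tmode0r; apply: EF_zero.
- move=> N a w y _ IHw _ IHy u n M MN; rewrite tmode_linear.
  by apply: EF_lin; [exact: IHw|exact: IHy].
Qed.

Lemma EF_C2 N v n w : C2 v -> n < 0 -> EF N w ->
  EF (N + mdepth n + 1) (tmode v n w).
Proof.
move=> + n0 hw; set A := EF _; have hA : subspace A by exact: subspace_EF.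
have [hn|hn] := boolP (n * T%:R \is a Num.int); last first.
  by move=> _; rewrite tmode_exponent//; apply: subspace0.
move: v; apply: lspan_sub.
  exact: (subspace_preim (@tmode_linearl _ _ _ _ W n w)).
move=> _ [u [v ->]] /=; have [f [hf ->]] := eigen_decomp hg hT u.
rewrite (linsum (vmode_linearl (-2) v)) (linsum (@tmode_linearl _ _ _ _ W n w)).
apply: subspace_sum => // r.
have r0 : 0 <= r%:R / T%:R :> rat by rewrite divr_ge0.
have r1 : r%:R / T%:R < 1 :> rat.
  by rewrite ltr_pdivrMr// mul1r ltr_nat.
have kr : -1 <= mdepth (r%:R / T%:R) by rewrite mdepth_ge.
have hr : coset T r (r%:R / T%:R) by rewrite /coset /= subrr.
(* The index r/T lies in [0, 1) and has depth -1. In the Jacobi identity with l = -2 each pair of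
   modes then has total depth at least -1 + 2 + [mdepth n], which is the gain of one. *)
have -> : n = r%:R / T%:R + (n - r%:R / T%:R) by rewrite addrC subrK.
have kn : mdepth n <= mdepth (n - r%:R / T%:R) by apply: mdepth_anti; lra.
apply: (tmode_iter_mem hT hA (hf r) hr) => i.
- move=> x; apply: EF_tmode hw _.
  by rewrite (addrC (_ / _)) subrK mdepthBnat; lia.
- apply: (EF_tmode (N := N + mdepth (n - r%:R / T%:R + i%:R))).
    exact: EF_tmode hw _.
  rewrite mdepthBnat mdepthDnat (_ : - 2 = (-2)%:~R)// mdepthDint; lia.
- apply: (EF_tmode (N := N + mdepth (r%:R / T%:R + i%:R))).
    exact: EF_tmode hw _.
  rewrite mdepthBnat mdepthDnat (_ : - 2 = (-2)%:~R)// mdepthDint; lia.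
Qed.

Lemma EF_C2T w : C2T w -> EF 1 w.
Proof.
apply: lspan_sub; first exact: subspace_EF.
move=> _ [p [u [w' [_ ->]]]]; apply: (@EF_tmode _ 0); first exact: EF_top.
rewrite add0r mdepth_ge; have : p%:R / T%:R < 1 :> rat.
  by rewrite ltr_pdivrMr// mul1r ltr_nat.
by rewrite rmorphN /=; lra.
Qed.

(** Vectors headed by a mode of index at most -d. Recording the depth of the tail up to a loss [c]
    is what allows the step from d to d + 1/T to be repeated. *)
Definition HF d N c : set W := lspan [set w | exists v n y,
  [/\ n <= - d, EF (N - mdepth n - c) y & w = tmode v n y]].

Lemma HF_tmode d N c v n y :
  n <= - d -> EF (N - mdepth n - c) y -> HF d N c (tmode v n y).
Proof. by move=> h1 h2; apply: sub_lspan; exists v, n, y. Qed.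

(** Modes of index in [-1, 0) have depth 0, so a word of positive depth has a mode of index below
    -1, hence at most -1 - 1/T. Commuting it to the front merges it only with modes of negative
    index, which keeps the bound. *)
Lemma HF_base N w : EF N w -> 1 <= N -> HF (1 + T%:R^-1) N 0 w.
Proof.
elim=> {N w} [N w|u n N M w n0 h IH NM M1|N _|N a w y _ IHw _ IHy N1].
- lia.
- have hM : subspace (HF (1 + T%:R^-1) M 0) by exact: subspace_lspan.
  have [n1|n1] := ltP n (-1).
    have [hn|hn] := boolP (n * T%:R \is a Num.int); last first.
      by rewrite tmode_exponent//; apply: subspace0.
    apply: HF_tmode; last by apply: EF_mono h _; lia.
    rewrite -(ler_pM2r T0) mulNr mulrDl mulVf ?gt_eqF// mul1r.
    have {n1} : n * T%:R < - T%:R by rewrite -mulN1r ltr_pM2r.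
    move: hn => /intrP[z ->] zT; have {}zT : z < - T%:Z.
      by rewrite -(ltr_int rat) rmorphN.
    have : z <= - (T%:Z + 1) by lia.
    by rewrite -(ler_int rat) rmorphN rmorphD.
  have kn : mdepth n = 0.
    have : (0 <= mdepth n) by rewrite mdepth_geq0.
    have : (1 <= mdepth n) = false by rewrite mdepth_ge rmorphN ltNge n1.
    lia.
  have : HF (1 + T%:R^-1) N 0 w by apply: IH; lia.
  move: w {h IH}; apply: lspan_sub.
    exact: (subspace_preim (tmode_linear u n)).
  move=> _ [v [b [y [hb hy ->]]]] /=.
  apply: (subspaceBr (y := tmode v b (tmode u n y)) hM).
    apply: (tmode_comm_mem hg hT) => // i x; apply: HF_tmode.
      by have : 0 <= i%:R :> rat by []; lra.
    by apply: EF_mono hy _; have := mdepth_super n b i; lia.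
  by apply: HF_tmode => //; apply: EF_tmode hy _; lia.
- exact: subspace0 (subspace_lspan _).
- by case: (subspace_lspan [set w | exists v n y,
    [/\ n <= - (1 + T%:R^-1), EF (N - mdepth n - 0) y & w = tmode v n y]]) => _;
  apply; [apply: IHw|apply: IHy].
Qed.

(* Associativity merges two leading modes of index at most [- d] into modes of
   index at most [- d - 1/T]. The loss [c] accounts for floors: [mdepth] is only
   superadditive up to 1. *)
Lemma HF_step d c : 1 + T%:R^-1 <= d -> 0 <= c ->
  (forall N w, c <= N -> EF N w -> HF d N c w) ->
  exists2 c', 0 <= c' &
    forall N w, c' <= N -> EF N w -> HF (d + T%:R^-1) N c' w.
Proof.
have Ti0 : 0 < T%:R^-1 :> rat by rewrite invr_gt0.
have Ti1 : T%:R^-1 <= 1 :> rat.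
  by rewrite invf_le1// ler1n; case: hT.
move=> hd c0 IH; set K := mdepth (- (d + T%:R^-1)).
have K0 : 0 <= K by rewrite mdepth_geq0; lra.
have [c' hc'] : exists c' : int, c' = 2 * c + 1 + K by eexists.
exists c' => [|N w hN /IH]; first by lia.
have hH : subspace (HF (d + T%:R^-1) N c') by exact: subspace_lspan.
move=> /(_ ltac:(lia)); move: w; apply: lspan_sub => //.
move=> _ [v [n [y [hn hy ->]]]].
have [n1|n1] := leP n (- (d + T%:R^-1)).
  by apply: HF_tmode => //; apply: EF_mono hy _; lia.
have nK : mdepth n <= K by apply/mdepth_anti/ltW.
clearbody K.
have := IH _ _ _ hy => /(_ ltac:(lia)).
move: y {hy}; apply: lspan_sub.
  exact: (subspace_preim (tmode_linear v n)).
move=> _ [v' [n' [y [hn' hy ->]]]] /=.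
(* The merged modes have index at most 1 - 2 d <= -d - 1/T. The other terms are headed by a mode of
   index at most -d - 1. *)
have [m nm] : exists m, n = m - 1 by exists (n + 1); rewrite addrK.
have km : mdepth n = mdepth m + 1 by rewrite nm (mdepthBnat m 1).
rewrite nm; apply: (tmode_assoc_mem hg hT) => // i; rewrite -?nm.
- have i0 : 0 <= i%:R :> rat by [].
  move=> x; apply: HF_tmode; first by lra.
  by apply: EF_mono hy _; have := mdepth_super m n' i; lia.
- have i0 : 0 <= i.+1%:R - 1 :> rat by rewrite -natr1 addrK.
  apply: HF_tmode; first by lra.
  by apply: EF_tmode hy _; rewrite mdepthDnat mdepthBnat; lia.
- have i0 : 0 <= i%:R :> rat by [].
  apply: HF_tmode; first by lra.
  apply: EF_tmode hy _; rewrite mdepthDnat mdepthBnat (mdepthBnat n' 1).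
  lia.
Qed.

(** [HF_base] gives the bound 1 + 1/T and each [HF_step] adds 1/T, so T |ceil d| steps reach beyond
    d. *)
Lemma EF_deep d : exists N, EF N `<=` lspan [set w | exists v n (y : W),
  n <= - d /\ w = tmode v n y].
Proof.
have Ti0 : 0 < T%:R^-1 :> rat by rewrite invr_gt0.
have H j : exists2 c, 0 <= c &
    forall N w, c <= N -> EF N w -> HF (1 + j.+1%:R / T%:R) N c w.
  elim: j => [|j [c c0 /HF_step]].
    exists 1 => // N w N1 /HF_base/(_ N1).
    apply: lspan_mono => _ [v [n [y [h1 h2 ->]]]]; apply: HF_tmode => //.
      by rewrite mul1r.
    by apply: EF_mono h2 _; lia.
  move=> []//; first by rewrite lerD2l ler_peMl ?ler1n// ltW.
  move=> c' c'0 h; exists c' => //.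
  by rewrite -[j.+2%:R]natr1 mulrDl mul1r addrA.
have [c c0 h] := H (T * `|Num.ceil d|)%N; exists c => w /(h _ _ (lexx c)).
apply: lspan_mono => _ [v [n [y [h1 _ ->]]]]; apply: sub_lspan.
exists v, n, y; split=> //; apply: le_trans h1 _; rewrite lerN2.
rewrite -natr1 natrM mulrDl mulrAC divff ?gt_eqF// mul1r.
have : d <= `|Num.ceil d|%:R.
  apply: le_trans (ceil_ge _) _; rewrite pmulrn ler_int.
  by move: (Num.ceil d) => z; lia.
lra.
Qed.

End Filtration.

(** * Words and sorting *)

Lemma perm_middle (X : eqType) (q r : seq X) a :
  perm_eq (q ++ a :: r) (a :: q ++ r).
Proof. by rewrite -cat1s perm_catCA. Qed.

Section Words.
Variables (R : realType) (V : vertexAlgebra R) (g : V -> V) (T : nat).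
Hypotheses (hg : linear g) (hT : has_period g T).
Variable W : twistedModule g T.
Implicit Types (p q s : seq (V * rat)) (a b : V * rat) (w y : W) (n : rat).
Implicit Types N M : int.

Definition word s w : W := foldr (fun a y => tmode a.1 a.2 y) w s.
Definition negw s := all (fun a => a.2 < 0) s.
Definition depth s : int := \sum_(a <- s) mdepth a.2.

Lemma word_cat p q w : word (p ++ q) w = word p (word q w).
Proof. exact: foldr_cat. Qed.

Lemma word_linear s : linear (word s).
Proof.
elim: s => [//|a s IH] c x y; have := IH c x y; rewrite /word /= => ->.
exact: tmode_linear.
Qed.

Lemma word_linearl s n y : linear (fun v => word s (tmode v n y)).
Proof.
by move=> c u v; rewrite (@tmode_linearl _ _ _ _ W n y) word_linear.
Qed.

Lemma depth_cons a s : depth (a :: s) = mdepth a.2 + depth s.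
Proof. exact: big_cons. Qed.

Lemma depth_cat p q : depth (p ++ q) = depth p + depth q.
Proof. exact: big_cat. Qed.

Lemma EF_word s N M w : EF N w -> M <= N + depth s -> EF M (word s w).
Proof.
elim: s M => [|a s IH] M hw.
  by rewrite /depth big_nil addr0; apply: EF_mono.
rewrite depth_cons /= => MN; apply: (EF_tmode hg hT (N := N + depth s)).
  exact: IH.
lia.
Qed.

Variables (SU : set V) (SM : set W).
Hypotheses (hV : forall v, addset (lspan SU) (C2 (V := V)) v)
  (hW : forall w, addset (lspan SM) (EF 1) w).

(** Increasing indices mean decreasing depths. [SU] and [SM] are mere generating sets, so that they
    can later consist of homogeneous vectors. *)
Definition sorted_words : set W := [set x | exists s w,
  [/\ (0 < size s)%N, negw s, forall a, a \in s -> SU a.1,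
      SM w & sorted (fun a b => a.2 <= b.2) s /\ x = word s w]].

(** The target for words of depth at least N: sorted words up to an error that gains one degree. *)
Definition modEF N := addset (lspan sorted_words) (@EF _ _ _ _ W (N + 1)).

Lemma subspace_modEF N : subspace (modEF N).
Proof.
by apply: subspace_addset; [exact: subspace_lspan|exact: subspace_EF].
Qed.

Lemma EF_modEF N w : EF (N + 1) w -> modEF N w.
Proof. by apply: addset_r; exact: subspace_lspan. Qed.

Lemma sorted_modEF N w : sorted_words w -> modEF N w.
Proof. by move=> /sub_lspan; apply: addset_l; exact: subspace_EF. Qed.

(** Writing [v] as a combination of elements of [SU] plus an element of C_2(V), the latter gains one
    degree by [EF_C2]. *)
Lemma letter_modEF N M p v n y : n < 0 -> EF M y ->
  N <= depth p + mdepth n + M ->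
  (forall u, SU u -> modEF N (word p (tmode u n y))) ->
  modEF N (word p (tmode v n y)).
Proof.
move=> n0 hy hN hu; have [u u1 [c c1 <-]] := hV v.
rewrite (linD (word_linearl p n y)).
apply: subspaceD; first exact: subspace_modEF.
  move: u u1; apply: lspan_sub => //.
  exact: (subspace_preim (word_linearl p n y) (@subspace_modEF N)).
apply: EF_modEF; apply: EF_word; first exact: (EF_C2 hg hT c1 n0 hy).
lia.
Qed.

(** Sorted words are nonempty, so a vector x of [SM] is written as the one-letter word of the vacuum
    mode of index -1, of depth 0, and the letter is then replaced. *)
Lemma nil_modEF N w : N <= 0 -> modEF N w.
Proof.
move=> N0; have [x hx [e he <-]] := hW w.
apply: subspaceD; first exact: subspace_modEF; last first.
  by apply: EF_modEF; apply: EF_mono he _; lia.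
move: x hx; apply: lspan_sub; first exact: subspace_modEF.
move=> x hx; have -> : x = word [::] (tmode (vac V) (-1) x).
  by rewrite /= tw_vacuum eqxx.
have k1 : 0 <= mdepth (-1) by rewrite mdepth_geq0.
apply: (@letter_modEF _ 0) => //; first exact: EF_top.
  by rewrite /depth big_nil; lia.
move=> u hu; apply: sorted_modEF; exists [:: (u, -1)], x.
by split=> // a; rewrite inE => /eqP ->.
Qed.

(** * Sorting the words of a fixed length *)

Section SortStep.
Variables (l : nat) (N : int).
Hypothesis short_words : forall s w,
  (size s <= l)%N -> negw s -> N <= depth s -> modEF N (word s w).

Definition long s := [/\ size s = l.+1, negw s & N <= depth s].

Lemma long_perm s t : perm_eq s t -> long s -> long t.
Proof.
move=> st [h1 h2 h3]; split; first by rewrite -(perm_size st).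
  by rewrite /negw -(perm_all _ st).
by rewrite /depth -(perm_big _ st).
Qed.

(** The commutator of two neighbours gives words with one letter fewer, still with negative indices
    and no smaller depth, to which [short_words] applies. *)
Lemma swap_modEF p q a b w : long (p ++ a :: b :: q) ->
  modEF N (word (p ++ a :: b :: q) w - word (p ++ b :: a :: q) w).
Proof.
move=> [h1 h2 h3]; rewrite !word_cat /= -(linB (word_linear p)).
have hA := subspace_preim (word_linear p) (@subspace_modEF N).
apply: (@tmode_comm_mem _ _ _ _ hg hT _ _ a.1 b.1 (word q w) _ _ hA) => i x /=.
rewrite -[tmode x _ _]/(word ((x, a.2 + b.2 - i%:R) :: q) w) -word_cat.
move: h1 h2 h3; rewrite size_cat /= /negw !all_cat /= !depth_cat !depth_cons /=.
move=> h1 /and4P[hp ha hb hq] h3; have i0 : 0 <= i%:R :> rat by [].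
apply: short_words; first by rewrite size_cat /=; lia.
  by rewrite /negw all_cat /= hp hq andbT /=; lra.
by rewrite depth_cat depth_cons /=; have := mdepth_super a.2 b.2 i; lia.
Qed.

Lemma front_modEF p q r a w : long (p ++ q ++ a :: r) ->
  modEF N (word (p ++ q ++ a :: r) w - word (p ++ a :: q ++ r) w).
Proof.
elim: q p => [|b q IH] p hl.
  by rewrite /= subrr; apply: subspace0; exact: subspace_modEF.
have := IH (rcons p b); rewrite !cat_rcons => /(_ hl) h.
apply: (subspaceBr (y := word (p ++ b :: a :: q ++ r) w
  - word (p ++ a :: b :: q ++ r) w) (subspace_modEF N)).
  by rewrite opprB addrA subrK.
apply: swap_modEF; apply: long_perm hl.
by rewrite perm_cat2l /= perm_cons perm_middle.
Qed.

(** The first letter of [t] is brought to the front of [s] and then joins the fixed prefix [p]. *)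
Lemma perm_modEF p s t w : perm_eq s t -> long (p ++ s) ->
  modEF N (word (p ++ s) w - word (p ++ t) w).
Proof.
elim: t p s => [|a t IH] p s st hl.
  move/perm_nilP: st => ->; rewrite subrr; apply: subspace0.
  exact: subspace_modEF.
have as_ : a \in s by rewrite (perm_mem st) mem_head.
case/splitPr: as_ st hl => q r st hl.
have st' : perm_eq (q ++ r) t.
  by rewrite -(perm_cons a) -(permPr st) perm_sym perm_middle.
have hl' : long (rcons p a ++ (q ++ r)).
  by apply: long_perm hl; rewrite cat_rcons perm_cat2l perm_middle.
have := subspaceD (subspace_modEF N) (front_modEF w hl) (IH _ _ st' hl').
by rewrite !cat_rcons addrA subrK.
Qed.

(** To be read backwards: [H3] replaces the letters from left to right by elements of [SU], [H2]
    replaces the vector by elements of [SM] at the cost of an error in E_1, and [H1] sorts the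
    result. *)
Lemma long_modEF s w : long s -> modEF N (word s w).
Proof.
have H1 t y : long t -> (forall a, a \in t -> SU a.1) -> SM y ->
    modEF N (word t y).
  move=> hl hU hy; set leT := fun a b : V * rat => a.2 <= b.2.
  have ts : perm_eq t (sort leT t) by rewrite perm_sym perm_sort.
  apply: (subspaceBr _ (perm_modEF (p := [::]) y ts hl)).
    exact: subspace_modEF.
  have [h1 h2 h3] := long_perm ts hl.
  apply: sorted_modEF; exists (sort leT t), y; split=> //; first by rewrite h1.
    by move=> a; rewrite mem_sort; apply: hU.
  by split=> //; apply: sort_sorted => a b; exact: le_total.
have H2 t y : long t -> (forall a, a \in t -> SU a.1) -> modEF N (word t y).
  move=> hl hU; have [x hx [e he <-]] := hW y.
  rewrite (linD (word_linear t)); apply: subspaceD.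
  - exact: subspace_modEF.
  - move: x hx; apply: lspan_sub => [|x hx]; last exact: H1.
    exact: (subspace_preim (word_linear t) (@subspace_modEF N)).
  - by apply: EF_modEF; apply: EF_word he _; case: hl => _ _; lia.
suff H3 t r : long (r ++ t) -> (forall a, a \in r -> SU a.1) ->
    modEF N (word (r ++ t) w).
  by move=> hl; apply: (H3 s [::]).
elim: t r => [|[v n] t IH] r; first by rewrite cats0; exact: H2.
move=> hl hU; have [h1 h2 h3] := hl; rewrite word_cat /=.
apply: (@letter_modEF _ (depth t)).
- by move: h2; rewrite /negw all_cat /= => /and3P[].
- apply: EF_word (EF_top _ (lexx 0)) _; lia.
- by move: h3; rewrite depth_cat depth_cons addrA.
move=> u hu; have := IH (rcons r (u, n)); rewrite cat_rcons word_cat /=.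
apply; last by move=> a; rewrite mem_rcons inE => /orP[/eqP -> //|]; exact: hU.
case: hl => e1 e2 e3; split; first by rewrite -e1 !size_cat.
  by move: e2; rewrite /negw !all_cat.
by move: e3; rewrite !depth_cat !depth_cons.
Qed.

End SortStep.

Lemma word_modEF N s w : negw s -> N <= depth s -> modEF N (word s w).
Proof.
move: {2}(size s) (leqnn (size s)) => l; elim: l s w => [|l IH] s w.
  rewrite leqn0 size_eq0 => /eqP -> _; rewrite /depth big_nil.
  exact: nil_modEF.
rewrite leq_eqVlt => /orP[/eqP h|]; last exact: IH.
by move=> h1 h2; apply: (@long_modEF l).
Qed.

Lemma EF_words N w : EF N w -> lspan [set x | exists s (y : W),
  [/\ negw s, N <= depth s & x = word s y]] w.
Proof.
elim=> {N w} [N w N0|u n N M w n0 _ IH MN|N|N c x y _ hx _ hy].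
- by apply: sub_lspan; exists [::], w; rewrite /depth big_nil.
- move: w IH; apply: lspan_sub.
    exact: (subspace_preim (tmode_linear u n) (@subspace_lspan _ _ _)).
  move=> _ [s [y [h1 h2 ->]]] /=; apply: sub_lspan; exists ((u, n) :: s), y.
  by split; [exact/andP|rewrite depth_cons /=; lia|].
- exact: subspace0 (@subspace_lspan _ _ _).
- by case: (@subspace_lspan _ _ [set x | exists s (y : W),
    [/\ negw s, N <= depth s & x = word s y]]) => _; apply.
Qed.

(** Starting from E_0 = W, each round applies [word_modEF] to the words spanning E_n and gains one
    degree. *)
Lemma sorted_words_dense N w : addset (lspan sorted_words) (@EF _ _ _ _ W N) w.
Proof.
have H (n : nat) : forall w, addset (lspan sorted_words) (@EF _ _ _ _ W n%:Z) w.
  elim: n => [|n IH] {}w.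
    by apply: addset_r; [exact: subspace_lspan|exact: EF_top].
  have [x hx [e he <-]] := IH w.
  have -> : n.+1%:Z = n%:Z + 1 by lia.
  apply: (subspaceD (@subspace_modEF n)).
    by apply: addset_l hx; exact: subspace_EF.
  move: e {he} (EF_words he); apply: lspan_sub; first exact: subspace_modEF.
  by move=> _ [s [y [h1 h2 ->]]]; apply: word_modEF.
have [x hx [e he <-]] := H (absz N) w.
by exists x => //; exists e => //; apply: EF_mono he _; lia.
Qed.

End Words.

(** * Gradings and the spanning vectors *)

Section Gradings.
Variables (K : fieldType) (V : lmodType K) (I : choiceType) (G : I -> set V).

Lemma fsum_finE (D : set I) (f : I -> V) : finite_set D ->
  [set i | f i != 0] `<=` D ->
  \sum_(i \in [set: I]) f i = \sum_(i <- finmap.enum_fset (fset_set D)) f i.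
Proof.
move=> fD sD; rewrite -fsbig_finite//; apply/esym/fsbig_widen => // i [_ Di] /=.
by apply/eqP/negPn/negP => /sD.
Qed.

Lemma fsum_lin (f f' : I -> V) (a : K) : finite_set [set i | f i != 0] ->
  finite_set [set i | f' i != 0] ->
  finite_set [set i | a *: f i + f' i != 0] /\
  \sum_(i \in [set: I]) (a *: f i + f' i) =
  a *: (\sum_(i \in [set: I]) f i) + \sum_(i \in [set: I]) f' i.
Proof.
move=> h h'; set D := [set i | f i != 0] `|` [set i | f' i != 0].
have fD : finite_set D by rewrite finite_setU.
have sD : [set i | a *: f i + f' i != 0] `<=` D.
  move=> i /= h0; have [fi|fi] := eqVneq (f i) 0; last by left.
  by right; move: h0; rewrite fi scaler0 add0r.
split; first exact: sub_finite_set sD fD.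
rewrite !(fsum_finE fD)//; [|by move=> i ?; right|by move=> i ?; left].
by rewrite big_split -scaler_sumr.
Qed.

Lemma hom_decomp_lin (f f' : I -> V) (a : K) u v : (forall i, subspace (G i)) ->
  hom_decomp G f u -> hom_decomp G f' v ->
  hom_decomp G (fun i => a *: f i + f' i) (a *: u + v).
Proof.
move=> hG [h1 h2 ->] [h1' h2' ->]; have [h3 h4] := fsum_lin a h2 h2'.
by split=> // i; case: (hG i) => _; apply.
Qed.

Lemma hom_decomp1 j v : (forall i, subspace (G i)) -> G j v ->
  hom_decomp G (fun i => if i == j then v else 0) v.
Proof.
move=> hG hv.
have sj : [set i | (if i == j then v else 0) != 0] `<=` [set j].
  by move=> i /=; case: ifP => [/eqP//|_]; rewrite eqxx.
split.
- by move=> i; case: eqP => [->//|_]; exact: subspace0 (hG i).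
- by apply: (@sub_finite_set _ _ [set j] sj).
- rewrite (@fsum_finE [set j])//.
  by rewrite -fsbig_finite// fsbig_set1 eqxx.
Qed.

(** By uniqueness, exhibiting any decomposition of a vector computes its projections; linearity
    follows in the same way. *)
Lemma direct_sum_proj : direct_sum G -> exists pr : I -> V -> V,
  [/\ forall i, linear (pr i), forall i v, G i v -> pr i v = v
    & forall i j v, i != j -> G j v -> pr i v = 0].
Proof.
move=> [hG h]; have [F hF] := choice h.
have Fu v f : hom_decomp G f v -> F v = f by case: (hF v) => _; apply.
exists (fun i v => F v i); split.
- move=> i a u v; have [hu _] := hF u; have [hv _] := hF v.
  by rewrite (Fu _ _ (hom_decomp_lin a hG hu hv)).
- by move=> i v hv; rewrite (Fu _ _ (hom_decomp1 hG hv)) eqxx.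
- by move=> i j v ij hv; rewrite (Fu _ _ (hom_decomp1 hG hv)) (negbTE ij).
Qed.

Lemma hom_decomp_lspan f v : hom_decomp G f v ->
  lspan [set x | exists i, G i x] v.
Proof.
move=> [h _ ->]; apply: subspace_fsum; first exact: subspace_lspan.
by move=> i _; apply: sub_lspan; exists i.
Qed.

Lemma direct_sum_lspan v : direct_sum G -> lspan [set x | exists i, G i x] v.
Proof. by move=> [_ /(_ v)[f [/hom_decomp_lspan]]]. Qed.

End Gradings.

Lemma graded_lspan (K : fieldType) (V : lmodType K) (I : choiceType)
  (G : I -> set V) (U : set V) u : graded_subspace G U -> U u ->
  lspan [set x | exists i, U x /\ G i x] u.
Proof. by move=> [_ h] /h[f /hom_decomp_lspan]. Qed.

Section SpanningVectors.
Variables (R : realType) (V : vertexAlgebra R) (g : V -> V) (T : nat).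
Hypotheses (hg : linear g) (hT : has_period g T).
Variables (W : twistedModule g T) (U : set V) (M : set W).
Hypothesis hUg : graded_subspace (@eigenspace_of R V g T) U.

(** Since [U] is graded by the eigenspaces of g, the relevant eigencomponent of [u] stays in [U]. *)
Lemma tmode_componentU u m : U u -> m * T%:R \is a Num.int ->
  exists (r : 'I_T) (u' : V), [/\ U u', eigenspace_of g r u', coset T r m
    & forall w : W, tmode u m w = tmode u' m w].
Proof.
move=> Uu /(mem_coset hT)[r hr]; case: hUg => _ /(_ u Uu)[f [hf _ ->]].
exists r, (f r); split; [exact: (hf r).1|exact: (hf r).2|by []|move=> w].
rewrite (@fsbigE _ _ _ _ _ (index_enum 'I_T)) ?index_enum_uniq//; last first.
  by move=> i _; rewrite mem_index_enum.
rewrite (eq_bigl xpredT) => [|i]; last exact: in_setT.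
by apply: tmode_eigensum => // s; exact: (hf s).2.
Qed.

Lemma coset_index (r : 'I_T) n : coset T r n -> n < 0 ->
  n = - 1 - `|mdepth n|%:R + r%:R / T%:R.
Proof.
have Tp : 0 < T%:R :> rat by rewrite ltr0n; case: hT.
move=> /intrP[z hz] n0; have r0 : 0 <= r%:R / T%:R :> rat by rewrite divr_ge0.
have r1 : r%:R / T%:R < 1 :> rat by rewrite ltr_pdivrMr// mul1r ltr_nat.
have e : n = r%:R / T%:R + z%:~R by rewrite -hz addrC subrK.
have k0 : 0 <= mdepth n by rewrite mdepth_geq0.
have -> : `|mdepth n|%:R = (mdepth n)%:~R :> rat.
  by rewrite -[in RHS](gez0_abs k0).
rewrite {2}e mdepthDint.
have -> : mdepth (r%:R / T%:R) = -1.
  apply/eqP; rewrite eq_le mdepth_ge r1 andbT leNgt.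
  by rewrite -lezD1 mdepth_ge -leNgt.
rewrite rmorphB /= {1}e; lra.
Qed.

Lemma word_nonint (s : seq (V * rat)) a (w : W) :
  a \in s -> a.2 * T%:R \isn't a Num.int -> word s w = 0.
Proof.
elim: s => // b s IH; rewrite inE => /orP[/eqP <- h|/IH{}IH h] /=.
  exact: tmode_exponent.
by move: (IH h); rewrite /word => ->; exact: tmode0r.
Qed.

(** A word with an index outside (1/T) Z is 0. Otherwise each index determines its r_i and k_i, and
    replacing each letter by its eigencomponent for r_i does not change the word. *)
Lemma word_spanning s w : (0 < size s)%N -> negw s ->
  (forall a, a \in s -> U a.1) -> M w ->
  sorted (fun a b : V * rat => a.2 <= b.2) s ->
  lspan (spanning_vectors U M) (word s w).
Proof.
move=> s0 /allP sneg sU Mw sS.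
have [/allP sint|/allPn[a /word_nonint h /h ->]] :=
    boolP (all (fun a => a.2 * T%:R \is a Num.int) s); last first.
  exact: subspace0 (@subspace_lspan _ _ _).
pose a0 : V * rat := (0, 0); pose b (i : 'I_(size s)) := nth a0 s i.
have bs i : b i \in s by apply: mem_nth.
have H (i : 'I_(size s)) : exists d : V * 'I_T,
    [/\ U d.1, eigenspace_of g d.2 d.1 & forall y : W, tmode (b i).1 (b i).2 y =
      tmode d.1 (- 1 - `|mdepth (b i).2|%:R + d.2%:R / T%:R) y].
  have [r [u [h1 h2 h3 h4]]] := tmode_componentU (sU _ (bs i)) (sint _ (bs i)).
  exists (u, r); split=> // y; rewrite h4 {1}(coset_index h3)//.
  exact: sneg.
have [d hd] := choice H; apply: sub_lspan.
exists (size s), (fun i => (d i).1), (fun i => (d i).2),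
  (fun i => `|mdepth (b i).2|%N), w; split=> //.
- by move=> i; have [] := hd i.
- move=> i j ij; have := sorted_leq_nth _ _ a0 sS.
  move=> /(_ _ _ i j (ltn_ord i) (ltn_ord j) ij) => hb.
  have := mdepth_anti (hb _ _).
  have : 0 <= mdepth (b j).2 by rewrite mdepth_geq0 sneg.
  rewrite -/(b i) -/(b j) => ? /(_ _ _) h.
  suff : mdepth (b j).2 <= mdepth (b i).2 by lia.
  apply: h => [x y z|x] /=; [exact: le_trans|exact: lexx].
- have -> : word s w = word [seq b i | i <- enum 'I_(size s)] w.
    congr (word _ w); rewrite -[LHS](mkseq_nth a0) /mkseq -val_enum_ord.
    by rewrite -map_comp.
  rewrite /word foldr_map; elim: (enum _) => //= i e ->.
  by have [_ _ ->] := hd i.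
Qed.

End SpanningVectors.

(** * Comparison of weights and conclusion *)

Theorem proposition6p8 (R : realType) (V : vertexAlgebra R)
    (VG : int -> set V) (hVG : is_Zgrading VG)
    (t : int) (ht : forall n : int, n < t -> VG n `<=` [set 0])
    (g : V -> V) (hg : is_automorphism g) (T : nat) (hT : has_period g T)
    (U : set V) (hU : graded_subspace VG U)
    (hUg : graded_subspace (@eigenspace_of R V g T) U)
    (hUC : [set a + c | a in U & c in C2 (V := V)] = [set: V])
    (W : twistedModule g T) (WG : rat -> set W) (hWG : is_TNgrading VG WG)
    (M : set W) (hM : graded_subspace WG M)
    (hMC : [set a + c | a in M & c in C2T (W := W)] = [set: W]) :
  lspan (spanning_vectors U M) = [set: W].
Proof.
have [gl _ _] := hg; have [VGd _ _] := hVG; have [WGd WG0 WGm] := hWG.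
(* Generators are taken homogeneous so that every sorted word has a weight. *)
set SU : set V := [set u | exists h, U u /\ VG h u].
set SM : set W := [set w | exists j, M w /\ WG j w].
have hV v : addset (lspan SU) (C2 (V := V)) v.
  have : [set: V] v by []; rewrite -hUC => -[a ha [c hc <-]].
  by exists a; [exact: graded_lspan hU ha|exists c].
have hW w : addset (lspan SM) (@EF _ _ _ _ W 1) w.
  have : [set: W] w by []; rewrite -hMC => -[a ha [c hc <-]].
  exists a; first exact: graded_lspan hM ha.
  by exists c => //; apply: (EF_C2T gl hT).
have [pr [prl pr1 pr0]] := direct_sum_proj WGd.
apply/seteqP; split=> // w _; have := direct_sum_lspan w WGd.
move: w; apply: lspan_sub => [|w [j hw]]; first exact: subspace_lspan.
have Wneg k x : WG k x -> k < 0 -> x = 0.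
  move=> hx k0; apply: (WG0 k) hx => -[i ki]; move: k0; rewrite ki.
  by rewrite ltNge divr_ge0.
(* With d = j - t + 2 a vector v_n y with n <= -d has weight at least t + d - 1 = j + 1, for v of
   weight at least t and y of weight at least 0; hence E_N has no component of weight j. *)
have [N hN] := EF_deep gl hT W (j - t%:~R + 2).
have [x hx [e he xe]] := sorted_words_dense gl hT hV hW N w.
have hker : subspace (pr j @^-1` [set 0]).
  apply: (subspace_preim (prl j)); split=> // a u v -> ->.
  by rewrite scaler0 addr0.
have pe : pr j e = 0.
  move: e he {xe} => e /hN; move: e; apply: lspan_sub => //.
  move=> _ [v [n [y [hn ->]]]] /=.
  have := direct_sum_lspan v VGd; move: v; apply: lspan_sub.
    exact: (subspace_preim (@tmode_linearl _ _ _ _ W n y) hker).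
  move=> v [h hv] /=; have := direct_sum_lspan y WGd; move: y.
  apply: lspan_sub.
    exact: (subspace_preim (tmode_linear v n) hker).
  move=> y [k hy] /=.
  have [k0|k0] := ltP k 0.
    by rewrite (Wneg _ _ hy k0) tmode0r (lin0 (prl j)).
  have [h0|h0] := ltP h t.
    have -> : v = 0 by apply: ht hv.
    by rewrite (lin0 (@tmode_linearl _ _ _ _ W n y)) (lin0 (prl j)).
  apply: pr0 (WGm _ _ _ _ _ hv hy); move: h0; rewrite -(ler_int rat) => h0.
  by rewrite lt_eqF//; lra.
(* Projecting w = x + e to weight j removes e, and it keeps or kills each sorted word in x because
   such a word is homogeneous. *)
have -> : w = pr j x by rewrite -(pr1 j w hw) -xe (linD (prl j)) pe addr0.
move: x hx {xe}; apply: lspan_sub.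
  exact: (subspace_preim (prl j) (@subspace_lspan _ _ _)).
move=> _ [s [y [s0 sneg sU [k [My hy]] [sS ->]]]] /=.
have [i hi] : exists i, WG i (word s y).
  elim: s sU {s0 sneg sS} => [|a s IH] sU; first by exists k.
  have [|i hi] := IH; first by move=> b bs; apply: sU; rewrite inE bs orbT.
  have [h [_ hh]] := sU a (mem_head _ _).
  by eexists; apply: WGm hh hi.
have hs : lspan (spanning_vectors U M) (word s y).
  by apply: word_spanning => // a /sU[h []].
have [ij|ij] := eqVneq j i; first by rewrite pr1// ij.
by rewrite (pr0 _ _ _ ij hi); exact: subspace0 (@subspace_lspan _ _ _).
Qed.
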